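(* Let $k,s,t$ be nonnegative integers and let $a=4k+p$ with $2\le p\le5$, $b=4s+q$ with $2\le q\le5$, and $c=4t+l$ with $2\le l\le5$, where at most one of $p,l,q$ equals $2$. Let $\theta(a,c,b)$ be a weighted $\theta$-graph, and let $\theta(p,l,q)$ be any weighted graph obtained from it by performing $k$ path reductions on the path $P_a$, $t$ path reductions on the path $P_c$, and $s$ path reductions on the path $P_b$. Then $$i_+(\theta(a,c,b))=2(k+s+t)+i_+(\theta(p,l,q)),\qquad i_-(\theta(a,c,b))=2(k+s+t)+i_-(\theta(p,l,q)).$$
   Context: A weighted graph is a finite simple graph $G$ together with a weight function assigning a positive real number $w(e)>0$ to each edge $e$. If $V_G=\{v_1,\dots,v_n\}$, its weighted adjacency matrix $A(G)=(a_{ij})$ is the real symmetric $n\times n$ matrix with $a_{ij}=w(v_iv_j)$ if $v_iv_j$ is an edge and $a_{ij}=0$ otherwise. $i_+(G)$ and $i_-(G)$ denote the numbers of positive and negative eigenvalues of $A(G)$, counted with multiplicity. A $\theta$-graph $\theta(a,c,b)$ ($\min\{a,c,b\}\ge2$, at most one of $a,c,b$ equal to $2$) is obtained from three vertex-disjoint paths $P_a,P_c,P_b$ on $a$, $c$, $b$ vertices by identifying their three initial vertices and identifying their three terminal vertices. Path reduction: let $x\,y_1\,y_2\,y_3\,y_4\,z$ be a path in a weighted graph such that $y_1,y_2,y_3,y_4$ have degree $2$ and $x,z$ are distinct and nonadjacent, with $w(xy_1)=\omega_1$, $w(y_1y_2)=\omega_2$, $w(y_2y_3)=\omega_3$, $w(y_3y_4)=\omega_4$,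 $w(y_4z)=\omega_5$. The path reduction deletes $y_1,y_2,y_3,y_4$ and adds the edge $xz$ with weight $\dfrac{\omega_1\omega_3\omega_5}{\omega_2\omega_4}$. It is performed on one of the three constituent paths of the $\theta$-graph if $x\,y_1\,y_2\,y_3\,y_4\,z$ is a subpath of that path. *)

(* Defs.v *)
From mathcomp Require Import all_boot all_order all_algebra.
From mathcomp Require Import reals polyrcf.

Set Implicit Arguments.
Unset Strict Implicit.
Unset Printing Implicit Defensive.

Import Order.TTheory GRing.Theory Num.Theory.
Local Open Scope ring_scope.

(* The vertices range over a subset of an ambient finite type, so that deleting
   vertices does not change the carrier.  An edge is a two-element set of
   vertices; the value of [wt] on a set which is not an edge is irrelevant. *)
Record wgraph (R : realType) (T : finType) := WGraph {
  verts : {set T};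
  edges : {set {set T}};
  wt : {set T} -> R;
  edges_simple : forall e, e \in edges -> (e \subset verts) /\ #|e| = 2%N;
  wt_gt0 : forall e, e \in edges -> 0 < wt e
}.

Definition adj (R : realType) (T : finType) (G : wgraph R T) : rel T :=
  fun u v => [set u; v] \in edges G.

Definition deg (R : realType) (T : finType) (G : wgraph R T) (v : T) : nat :=
  #|[set e in edges G | v \in e]|.

Definition adjmx (R : realType) (T : finType) (G : wgraph R T) :
    'M[R]_#|verts G| :=
  \matrix_(i, j) if adj G (enum_val i) (enum_val j)
                 then wt G [set enum_val i; enum_val j] else 0.

(* [rootsR] lists the distinct real roots, hence the multiplicities. *)
Definition pos_inertia (R : realType) (T : finType) (G : wgraph R T) : nat :=
  let chi := char_poly (adjmx G) in
  (\sum_(x <- rootsR chi | (0 < x)%R) mup x chi)%N.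

Definition neg_inertia (R : realType) (T : finType) (G : wgraph R T) : nat :=
  let chi := char_poly (adjmx G) in
  (\sum_(x <- rootsR chi | (x < 0)%R) mup x chi)%N.

Definition path_edges (T : finType) (P : seq T) : seq {set T} :=
  [seq [set e.1; e.2] | e <- zip P (behead P)].

(* [G] is theta(a,c,b), with [Pa], [Pc], [Pb] as its three constituent paths,
   each listed from the common initial vertex to the common terminal vertex. *)
Definition is_theta (R : realType) (T : finType) (a c b : nat)
    (G : wgraph R T) (Pa Pc Pb : seq T) : Prop :=
  [/\ [/\ 2 <= a, 2 <= c & 2 <= b]%N,
      ((a == 2) + (c == 2) + (b == 2) <= 1)%N,
      [/\ size Pa = a, size Pc = c & size Pb = b],
      (exists (u v : T) (Ia Ic Ib : seq T),
        [/\ Pa = u :: rcons Ia v, Pc = u :: rcons Ic v, Pb = u :: rcons Ib v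
          & uniq [:: u, v & Ia ++ Ic ++ Ib]]) &
      verts G = [set x in Pa ++ Pc ++ Pb] /\
      edges G = [set e in path_edges Pa ++ path_edges Pc ++ path_edges Pb]].

(* [G'] is the path reduction of [G] along [x y1 y2 y3 y4 z]. *)
Definition path_reduction (R : realType) (T : finType) (G : wgraph R T)
    (x y1 y2 y3 y4 z : T) (G' : wgraph R T) : Prop :=
  let Y := [set y in [:: y1; y2; y3; y4]] in
  [/\ [/\ uniq [:: x; y1; y2; y3; y4; z],
          path (adj G) x [:: y1; y2; y3; y4; z],
          forall y, y \in Y -> deg G y = 2%N & ~~ adj G x z],
      verts G' = verts G :\: Y,
      edges G' = [set x; z] |: [set e in edges G | [disjoint e & Y]],
      wt G' [set x; z] =
        (wt G [set x; y1] * wt G [set y2; y3] * wt G [set y4; z])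
          / (wt G [set y1; y2] * wt G [set y3; y4]) &
      forall e, e \in edges G -> [disjoint e & Y] -> wt G' e = wt G e].

(* A path reduction of [G] performed along a subpath of the path [P];
   [P'] is what [P] becomes. *)
Definition reduction_on (R : realType) (T : finType) (G : wgraph R T)
    (P : seq T) (G' : wgraph R T) (P' : seq T) : Prop :=
  exists (s1 s2 : seq T) (x y1 y2 y3 y4 z : T),
    [/\ P = s1 ++ [:: x; y1; y2; y3; y4; z] ++ s2,
        P' = s1 ++ [:: x; z] ++ s2
      & path_reduction G x y1 y2 y3 y4 z G'].

(* [theta_reduces H k t s G Pa Pc Pb]: [H] is obtained from the theta-graph [G]
   by k, t, s path reductions, in any order, on the paths starting as
   [Pa], [Pc], [Pb] respectively. *)
Inductive theta_reduces (R : realType) (T : finType) (H : wgraph R T) :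
    nat -> nat -> nat -> wgraph R T -> seq T -> seq T -> seq T -> Prop :=
| theta_reduces_refl Pa Pc Pb : theta_reduces H 0 0 0 H Pa Pc Pb
| theta_reduces_a k t s G G' Pa Pa' Pc Pb :
    reduction_on G Pa G' Pa' -> theta_reduces H k t s G' Pa' Pc Pb ->
    theta_reduces H k.+1 t s G Pa Pc Pb
| theta_reduces_c k t s G G' Pa Pc Pc' Pb :
    reduction_on G Pc G' Pc' -> theta_reduces H k t s G' Pa Pc' Pb ->
    theta_reduces H k t.+1 s G Pa Pc Pb
| theta_reduces_b k t s G G' Pa Pc Pb Pb' :
    reduction_on G Pb G' Pb' -> theta_reduces H k t s G' Pa Pc Pb' ->
    theta_reduces H k t s.+1 G Pa Pc Pb.

(* Main.v *)
Require Import Defs.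
From mathcomp Require Import all_boot all_order all_algebra.
From mathcomp Require Import reals polyrcf complex.
From mathcomp Require Import ring zify.

(** A single path reduction, along any path x y1 y2 y3 y4 z of any weighted
    graph whose inner vertices have degree 2 and whose ends are distinct and
    nonadjacent, lowers both inertia indices by exactly 2; the theorem follows
    by counting the reductions.

    List the four inner vertices last, so that the weighted adjacency matrix of
    G is a block matrix with blocks A, B, B^T and D, where D is the adjacency
    matrix of the weighted path y1 y2 y3 y4.  The rows of B vanish except at x
    and z, and one solves B = X D explicitly.  The Schur complement
    A - X D X^T differs from A only at the positions (x, z) and (z, x), where
    the entry is w1 w3 w5 / (w2 w4): it is the adjacency matrix of the reduced
    graph.  By Haynsworth's additivity of inertia ([inertia_schur]) the indices
    of G are those of the reduced graph plus those of D, and D has two positive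
    and two negative eigenvalues ([inertia_path4mx]).

    The underlying form of Sylvester's law is [inertia_congruence_le]: if
    A = M B M^T for symmetric A and B and a possibly rectangular and singular M,
    then A has at most as many positive (negative) eigenvalues as B.  It is
    obtained from the spectral theorem for Hermitian matrices over R[i]. *)

Set Implicit Arguments.
Unset Strict Implicit.
Unset Printing Implicit Defensive.

Import Order.TTheory GRing.Theory Num.Theory.
Local Open Scope ring_scope.

(** * Counting eigenvalues *)

(** Number of positive eigenvalues of A: positive roots of its characteristic
    polynomial, with multiplicity.  On [adjmx G] it unfolds to
    [pos_inertia G]. *)
Definition mxpos (R : rcfType) n (A : 'M[R]_n) : nat :=
  (\sum_(x <- rootsR (char_poly A) | (0 < x)%R) mup x (char_poly A))%N.

(** Number of negative eigenvalues of A, with multiplicity. *)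
Definition mxneg (R : rcfType) n (A : 'M[R]_n) : nat :=
  (\sum_(x <- rootsR (char_poly A) | (x < 0)%R) mup x (char_poly A))%N.

Lemma sum_mup_rootsR (R : rcfType) (P : pred R) (s : seq R) :
  let p := \prod_(x <- s) ('X - x%:P) in
  (\sum_(x <- rootsR p | P x) mup x p)%N = count P s.
Proof.
move=> p; have p0 : p != 0 by rewrite monic_neq0 // monic_prod_XsubC.
have urs : uniq (rootsR p) := uniq_roots _ _ _.
have mem_rs x : x \in s -> x \in rootsR p.
  by move=> xs; rewrite -(roots_on_rootsR p0) in_itv /= root_prod_XsubC.
under eq_bigr do rewrite /p mu_prod_XsubC.
elim: s {p p0} (rootsR p) urs mem_rs => [|y s IHs] rs urs mem_rs /=.
  by rewrite big1.
rewrite big_split /= IHs //; last by move=> x xs; apply: mem_rs; rewrite inE xs orbT.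
congr addn.
rewrite (big_rem y) /= ?mem_rs ?mem_head // eqxx big_seq_cond big1 ?addn0.
  by case: (P y).
by move=> x /andP[]; rewrite mem_rem_uniq // inE => /andP[/negPf xy _ _];
  rewrite eq_sym xy.
Qed.

(** * Hermitian and real symmetric matrices *)

Section Hermitian.
Local Open Scope sesquilinear_scope.

Lemma char_poly_conj (F : fieldType) n (P A : 'M[F]_n) :
  P \in unitmx -> char_poly (invmx P *m A *m P) = char_poly A.
Proof.
move=> Pu; rewrite /char_poly.
have -> : char_poly_mx (invmx P *m A *m P) =
    map_mx polyC (invmx P) *m char_poly_mx A *m map_mx polyC P.
  rewrite /char_poly_mx mulmxBr mulmxBl !map_mxM /=; congr (_ - _).
  by rewrite scalar_mxC -mulmxA -map_mxM mulVmx // map_mx1 mulmx1.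
by rewrite !det_mulmx mulrAC -det_mulmx -map_mxM mulVmx // map_mx1 det1 mul1r.
Qed.

Lemma form_diag (C : numClosedFieldType) n (d : 'rV[C]_n) (v : 'rV[C]_n) :
  (v *m diag_mx d *m v^t*) 0 0 = \sum_i d 0 i * `|v 0 i| ^+ 2.
Proof.
rewrite mxE; apply: eq_bigr => i _.
by rewrite mul_mx_diag !mxE normCK; ring.
Qed.

(** Dimension count: if d had more positive entries than e, some nonzero v
    supported on the positive entries of d would be sent by M to a vector
    vanishing on the positive entries of e, and the form would be both positive
    and nonpositive on v. *)
Lemma diag_congruence_le (C : numClosedFieldType) n m
    (d : 'rV[C]_n) (e : 'rV[C]_m) (M : 'M[C]_(n, m)) :
    (forall j, e 0 j \is Num.real) ->
  diag_mx d = M *m diag_mx e *m M^t* ->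
  (#|[set i | (0 < d 0 i)%R]| <= #|[set j | (0 < e 0 j)%R]|)%N.
Proof.
move=> ereal dMe; set I := [set i | _]; set J := [set j | _].
rewrite leqNgt; apply/negP => ltJI.
(* E includes the coordinates in I, F projects onto the coordinates in J. *)
pose E : 'M[C]_(#|I|, n) := \matrix_(i, j) (enum_val i == j)%:R.
pose F : 'M[C]_(m, #|J|) := \matrix_(i, j) (i == enum_val j)%:R.
have FE k j : F k j = (k == enum_val j)%:R by rewrite mxE.
have : kermx (E *m M *m F) != 0.
  rewrite -mxrank_eq0 mxrank_ker subn_eq0 -ltnNge.
  exact: leq_ltn_trans (rank_leq_col _) ltJI.
case/rowV0Pn => w /sub_kermxP; rewrite !mulmxA => wEMF w0.
pose v := w *m E; pose u := v *m M.
have vE k : v 0 k = \sum_i w 0 i * (enum_val i == k)%:R.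
  by rewrite mxE; apply: eq_bigr => i _; rewrite mxE.
have v_enum i : v 0 (enum_val i) = w 0 i.
  rewrite vE (bigD1 i) //= eqxx mulr1 big1 ?addr0 // => j ji.
  by rewrite (inj_eq enum_val_inj) (negPf ji) mulr0.
have v_out k : k \notin I -> v 0 k = 0.
  move=> kI; rewrite vE big1 // => i _; case: eqP => [ik|]; last by rewrite mulr0.
  by rewrite -ik enum_valP in kI.
have u_in k : k \in J -> u 0 k = 0.
  move=> kJ; have /rowP/(_ (enum_rank_in kJ k)) := wEMF.
  rewrite [LHS]mxE [RHS]mxE => wEMFk; rewrite -[RHS]wEMFk.
  rewrite (bigD1 k) //= FE enum_rankK_in // eqxx mulr1 big1 ?addr0 // => j jk.
  by rewrite FE enum_rankK_in // (negPf jk) mulr0.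
have le0 : (v *m diag_mx d *m v^t*) 0 0 <= 0.
  rewrite dMe !mulmxA -/u -mulmxA -map_mxM -trmx_mul -/u form_diag.
  apply: sumr_le0 => k _; have [/u_in->|] := boolP (k \in J).
    by rewrite normr0 expr0n mulr0.
  rewrite inE -real_leNgt ?ereal // => ek.
  by rewrite mulr_le0_ge0 // exprn_ge0.
have [i wi] : exists i, w 0 i != 0 by apply/rV0Pn.
have : 0 < (v *m diag_mx d *m v^t*) 0 0.
  rewrite form_diag (bigD1 (enum_val i)) //= v_enum ltr_pwDl //.
    have := enum_valP i; rewrite inE => di.
    by rewrite mulr_gt0 // exprn_gt0 // normr_gt0.
  apply: sumr_ge0 => k _; have [|/v_out->] := boolP (k \in I).
    by rewrite inE => dk; rewrite mulr_ge0 // ?exprn_ge0 // ltW.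
  by rewrite normr0 expr0n mulr0.
by move=> /lt_le_trans/(_ le0); rewrite ltxx.
Qed.

(** The diagonalizing matrix is only claimed to be complex unitary; the
    eigenvalues are real. *)
Lemma symmetric_spectral (R : rcfType) n (A : 'M[R]_n) : A^T = A ->
  exists (d : 'rV[R]_n) (U : 'M[R[i]]_n),
    [/\ U *m U^t* = 1%:M, U^t* *m U = 1%:M,
        map_mx (real_complex R) A =
          U^t* *m diag_mx (map_mx (real_complex R) d) *m U
      & char_poly A = \prod_i ('X - (d 0 i)%:P)].
Proof.
move=> Asym; pose AC := map_mx (real_complex R) A.
have AH : AC \is hermsymmx.
  apply/is_hermitianmxP; rewrite expr0 scale1r.
  apply/matrixP => i j; rewrite !mxE -[A in LHS]Asym mxE.
  by apply/esym/CrealP/complex_realP; exists (A j i).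
have /orthomx_spectralP AE := hermitian_normalmx AH.
have dreal := hermitian_spectral_diag_real AH.
set U := spectralmx AC in AE; set e := spectral_diag AC in AE dreal.
have Uu : U \is unitarymx := spectral_unitarymx _.
pose d := map_mx (@complex.Re R) e.
have eE : e = map_mx (real_complex R) d.
  apply/rowP => i; rewrite !mxE RRe_real //.
  by have /mxOverP/(_ 0 i) := dreal.
exists d, U; split.
- exact/unitarymxP.
- by rewrite -invmx_unitary // mulVmx // unitarymx_unit.
- by rewrite -eE -invmx_unitary.
- apply: (map_poly_inj (real_complex R)).
  rewrite map_char_poly -/AC AE char_poly_conj ?unitarymx_unit //.
  rewrite char_poly_trig ?diag_mx_is_trig // rmorph_prod.
  apply: eq_bigr => i _; rewrite rmorphB /= map_polyX map_polyC /=.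
  by rewrite {1}eE !mxE eqxx mulr1n.
Qed.

End Hermitian.

(** * Inertia of real symmetric matrices *)

Section Inertia.
Variable R : rcfType.

Lemma inertia_spectrum n (A : 'M[R]_n) (d : 'rV[R]_n) :
  char_poly A = \prod_i ('X - (d 0 i)%:P) ->
  mxpos A = #|[set i | 0 < d 0 i]| /\ mxneg A = #|[set i | d 0 i < 0]|.
Proof.
have -> : \prod_i ('X - (d 0 i)%:P) =
    \prod_(x <- [seq d 0 i | i <- enum 'I_n]) ('X - x%:P).
  by rewrite big_map big_enum.
move=> Ad; rewrite /mxpos /mxneg Ad !sum_mup_rootsR !count_map.
by split; rewrite cardsE -sum1_card -sum1_count.
Qed.

(** Sylvester's law of inertia, as a monotonicity statement. *)
Lemma inertia_congruence_le n m (A : 'M[R]_n) (B : 'M[R]_m) (M : 'M[R]_(n, m)) :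
  A^T = A -> B^T = B -> A = M *m B *m M^T ->
  (mxpos A <= mxpos B)%N /\ (mxneg A <= mxneg B)%N.
Proof.
move=> As Bs AMB.
have [d [U [UU _ AU /inertia_spectrum[-> ->]]]] := symmetric_spectral As.
have [e [V [_ VV BV /inertia_spectrum[-> ->]]]] := symmetric_spectral Bs.
pose iC := real_complex R.
pose N := U *m map_mx iC M *m (V^T ^ Num.conj)%sesqui.
have Mconj : ((map_mx iC M)^T ^ Num.conj)%sesqui = map_mx iC M^T.
  apply/matrixP => i j; rewrite !mxE.
  by apply/CrealP/complex_realP; exists (M j i).
have dNe : diag_mx (map_mx iC d) =
    N *m diag_mx (map_mx iC e) *m (N^T ^ Num.conj)%sesqui.
  rewrite /N !trmx_mul !map_mxM /= trmxCK Mconj.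
  have -> : diag_mx (map_mx iC d) =
      U *m map_mx iC A *m (U^T ^ Num.conj)%sesqui.
    by rewrite AU !mulmxA UU mul1mx -mulmxA UU mulmx1.
  by rewrite AMB !map_mxM /= BV !mulmxA.
split.
  have -> : [set i | 0 < d 0 i] = [set i | 0 < map_mx iC d 0 i].
    by apply/setP => i; rewrite !inE mxE ltcR.
  have -> : [set i | 0 < e 0 i] = [set i | 0 < map_mx iC e 0 i].
    by apply/setP => i; rewrite !inE mxE ltcR.
  apply: diag_congruence_le dNe => j.
  by apply/complex_realP; exists (e 0 j); rewrite mxE.
(* Negative entries are the positive ones of the opposite diagonals. *)
have -> : [set i | d 0 i < 0] = [set i | 0 < (- map_mx iC d) 0 i].
  by apply/setP => i; rewrite !inE 2!mxE oppr_gt0 ltcR.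
have -> : [set i | e 0 i < 0] = [set i | 0 < (- map_mx iC e) 0 i].
  by apply/setP => i; rewrite !inE 2!mxE oppr_gt0 ltcR.
apply: (@diag_congruence_le _ _ _ _ _ N) => [j|].
  by apply/complex_realP; exists (- e 0 j); rewrite 2!mxE rmorphN.
by rewrite !raddfN /= dNe mulNmx.
Qed.

Lemma inertia_block n m (A : 'M[R]_n) (B : 'M[R]_m) : A^T = A -> B^T = B ->
  mxpos (block_mx A 0 0 B) = (mxpos A + mxpos B)%N /\
  mxneg (block_mx A 0 0 B) = (mxneg A + mxneg B)%N.
Proof.
move=> /symmetric_spectral[d [_ [_ _ _ Ad]]] /symmetric_spectral[e [_ [_ _ _ Be]]].
have chi (k : nat) (f : 'rV[R]_k) : \prod_i ('X - (f 0 i)%:P) =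
    \prod_(x <- [seq f 0 i | i <- enum 'I_k]) ('X - x%:P).
  by rewrite big_map big_enum.
have chiAB : char_poly (block_mx A 0 0 B) =
    \prod_(x <- [seq d 0 i | i <- enum 'I_n] ++ [seq e 0 i | i <- enum 'I_m])
      ('X - x%:P).
  rewrite /char_poly char_block_diag_mx det_ublock.
  by rewrite -/(char_poly A) -/(char_poly B) Ad Be !chi big_cat.
by rewrite /mxpos /mxneg chiAB Ad Be !chi !sum_mup_rootsR !count_cat.
Qed.

Lemma inertia_le_size n (A : 'M[R]_n) : A^T = A -> (mxpos A + mxneg A <= n)%N.
Proof.
move=> /symmetric_spectral[d [_ [_ _ _ /inertia_spectrum[-> ->]]]].
set P := [set i | _]; set N := [set i | _].
have -> : (#|P| + #|N|)%N = #|P :|: N|.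
  rewrite cardsU (_ : P :&: N = set0) ?cards0 ?subn0 //.
  by apply/setP => i; rewrite !inE; apply/negP => /andP[/lt_trans h/h];
     rewrite ltxx.
by rewrite -[leqRHS]card_ord max_card.
Qed.

(** Haynsworth's inertia additivity, in the form that needs no inverse of D:
    the off-diagonal block is given as X *m D, and the unipotent matrix with
    upper right block X is the congruence. *)
Lemma inertia_schur n m (A : 'M[R]_n) (X : 'M[R]_(n, m)) (D : 'M[R]_m) :
  A^T = A -> D^T = D ->
  let S := block_mx A (X *m D) (X *m D)^T D in
  mxpos S = (mxpos (A - X *m D *m X^T) + mxpos D)%N /\
  mxneg S = (mxneg (A - X *m D *m X^T) + mxneg D)%N.
Proof.
move=> As Ds S; set A' := A - _.
have A's : A'^T = A' by rewrite /A' raddfB /= !trmx_mul trmxK As Ds mulmxA.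
have Ss : S^T = S by rewrite tr_block_mx As trmxK Ds.
have Zs : (block_mx A' 0 0 D)^T = block_mx A' 0 0 D.
  by rewrite tr_block_mx A's Ds !trmx0.
have [<- <-] := inertia_block A's Ds.
have XDt : (X *m D)^T = D *m X^T by rewrite trmx_mul Ds.
have [p1 n1] : (mxpos S <= mxpos (block_mx A' 0 0 D))%N /\
    (mxneg S <= mxneg (block_mx A' 0 0 D))%N.
  apply: (@inertia_congruence_le _ _ _ _ (block_mx 1%:M X 0 1%:M)) => //.
  rewrite tr_block_mx !mulmx_block !trmx1 trmx0 /S.
  rewrite !(mul1mx, mulmx1, mul0mx, mulmx0, addr0, add0r).
  by rewrite /A' subrK XDt.
have [p2 n2] : (mxpos (block_mx A' 0 0 D) <= mxpos S)%N /\
    (mxneg (block_mx A' 0 0 D) <= mxneg S)%N.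
  apply: (@inertia_congruence_le _ _ _ _ (block_mx 1%:M (- X) 0 1%:M)) => //.
  rewrite tr_block_mx !mulmx_block !trmx1 trmx0 /S.
  rewrite !(mul1mx, mulmx1, mul0mx, mulmx0, addr0, add0r).
  rewrite linearN /= XDt !mulNmx !addrN !mul0mx !addr0.
  by rewrite mulmxN addrN mulmxA.
by split; apply/eqP; rewrite eqn_leq ?p1 ?p2 ?n1 ?n2.
Qed.

(** Neither f nor h is assumed injective.  With both inclusions of images, the
    inertia of a graph does not depend on how its vertices are listed. *)
Lemma inertia_reindex_le (T : Type) (g : T -> T -> R) n m
    (f : 'I_n -> T) (h : 'I_m -> T) :
  (forall u v, g u v = g v u) ->
  (forall i, exists j, f i = h j) ->
  let A := \matrix_(i, j) g (f i) (f j) in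
  let B := \matrix_(i, j) g (h i) (h j) in
  (mxpos A <= mxpos B)%N /\ (mxneg A <= mxneg B)%N.
Proof.
move=> gs fh A B.
have [s fE] : exists s : 'I_n -> 'I_m, forall i, f i = h (s i).
  by apply: (fin_all_exists (P := fun i j => f i = h j)).
pose M : 'M[R]_(n, m) := \matrix_(i, j) (s i == j)%:R.
apply: (@inertia_congruence_le _ _ _ _ M).
- by apply/matrixP => i j; rewrite !mxE.
- by apply/matrixP => i j; rewrite !mxE.
apply/matrixP => i j; rewrite !mxE (bigD1 (s j)) //= !mxE eqxx mulr1.
rewrite (bigD1 (s i)) //= !mxE eqxx mul1r -!fE.
rewrite big1 ?addr0 => [|k /negPf ki]; last by rewrite mxE eq_sym ki mul0r.
by rewrite big1 ?addr0 // => k /negPf ki; rewrite !mxE eq_sym ki mulr0.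
Qed.

Lemma inertia_reindex (T : Type) (g : T -> T -> R) n m
    (f : 'I_n -> T) (h : 'I_m -> T) :
  (forall u v, g u v = g v u) ->
  (forall i, exists j, f i = h j) -> (forall j, exists i, h j = f i) ->
  mxpos (\matrix_(i, j) g (f i) (f j)) = mxpos (\matrix_(i, j) g (h i) (h j)) /\
  mxneg (\matrix_(i, j) g (f i) (f j)) = mxneg (\matrix_(i, j) g (h i) (h j)).
Proof.
move=> gs fh hf; have [p1 n1] := inertia_reindex_le gs fh.
have [p2 n2] := inertia_reindex_le gs hf.
by split; apply/eqP; rewrite eqn_leq ?p1 ?p2 ?n1 ?n2.
Qed.

(** Adjacency matrix of the weighted path on 4 vertices with edge weights
    a, b, c. *)
Definition path4mx (a b c : R) : 'M[R]_4 :=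
  \matrix_(i, j) nth 0 (nth [::]
    [:: [:: 0; a; 0; 0]; [:: a; 0; b; 0]; [:: 0; b; 0; c]; [:: 0; 0; c; 0]] i) j.

Lemma path4mx_sym (a b c : R) : (path4mx a b c)^T = path4mx a b c.
Proof.
apply/matrixP => -[i ip] [j jp]; rewrite !mxE.
by case: i ip => [|[|[|[|]]]] //; case: j jp => [|[|[|[|]]]].
Qed.

(** On the planes spanned by the rows of [M 1] and of [M (-1)] below, the form
    is positive, respectively negative, definite. *)
Lemma inertia_path4mx (a b c : R) : 0 < a -> 0 < c ->
  mxpos (path4mx a b c) = 2%N /\ mxneg (path4mx a b c) = 2%N.
Proof.
move=> a0 c0; have Ds := path4mx_sym a b c; set D := path4mx _ _ _ in Ds *.
have a0' : a != 0 by rewrite gt_eqF.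
pose d (s : R) : 'rV[R]_2 := \row_j (s * nth 0 [:: 2 * a; 2 * c] j).
pose M (s : R) : 'M[R]_(2, 4) := \matrix_(i, j)
  nth 0 (nth [::] [:: [:: 1; s; 0; 0]; [:: - b / a; 0; 1; s]] i) j.
have dpos s j : 0 < s -> 0 < d s 0 j.
  by move=> s0; rewrite mxE; case: j => [[|[|]]] //= _; rewrite !mulr_gt0 // ltr0n.
have MD s : diag_mx (d s) = M s *m D *m (M s)^T.
  apply/matrixP => i j; rewrite [RHS]mxE.
  under eq_bigr do rewrite mxE.
  rewrite !big_ord_recl !big_ord0.
  by case: i => [[|[|//]] i2]; case: j => [[|[|//]] j2];
    rewrite !mxE /=; field.
have chi s : char_poly (diag_mx (d s)) = \prod_i ('X - (d s 0 i)%:P).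
  rewrite char_poly_trig ?diag_mx_is_trig //.
  by apply: eq_bigr => i _; rewrite !mxE eqxx mulr1n.
have ds s : (diag_mx (d s))^T = diag_mx (d s) by rewrite tr_diag_mx.
have [pD _] := inertia_congruence_le (ds 1) Ds (MD 1).
have [_ nD] := inertia_congruence_le (ds (-1)) Ds (MD (-1)).
have := inertia_le_size Ds.
rewrite (inertia_spectrum (chi 1)).1 (_ : [set i | _] = setT)
  ?cardsT ?card_ord in pD; last by apply/setP => i; rewrite !inE dpos.
rewrite (inertia_spectrum (chi (-1))).2 (_ : [set i | _] = setT)
  ?cardsT ?card_ord in nD; last first.
  by apply/setP => i; rewrite !inE mxE mulN1r oppr_lt0 -[X in 0 < X]mul1r;
     have := dpos 1 i ltr01; rewrite mxE.
move: pD nD; case: (mxpos D) => [|[|[|p]]] //; case: (mxneg D) => [|[|[|q]]] //;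
  by rewrite ?addnS ?addSn.
Qed.

End Inertia.

(** * Weighted adjacency and path reduction *)

Section Reduction.
Variables (R : realType) (T : finType).

(** The entry of the weighted adjacency matrix at (u, v), for arbitrary u and v
    of the ambient type. *)
Definition adjwt (G : wgraph R T) (u v : T) : R :=
  if adj G u v then wt G [set u; v] else 0.

Lemma adj_sym (G : wgraph R T) u v : adj G u v = adj G v u.
Proof. by rewrite /adj setUC. Qed.

Lemma adjwt_sym (G : wgraph R T) u v : adjwt G u v = adjwt G v u.
Proof. by rewrite /adjwt adj_sym setUC. Qed.

Lemma adj_irr (G : wgraph R T) u : adj G u u = false.
Proof.
by apply/negP => /edges_simple[_]; rewrite setUid cards1.
Qed.

Lemma adj_verts (G : wgraph R T) u v : adj G u v -> (u \in verts G) && (v \in verts G).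
Proof. by case/edges_simple; rewrite subUset !sub1set. Qed.

Lemma adj_deg2 (G : wgraph R T) y a b u :
    deg G y = 2%N -> a != b -> adj G y a -> adj G y b ->
  adj G y u = (u == a) || (u == b).
Proof.
move=> dy ab ya yb; apply/idP/idP => [yu|/orP[]/eqP-> //].
have ny c : adj G y c -> y != c.
  by apply: contraTneq => <-; rewrite adj_irr.
have inj c e : adj G y c -> adj G y e -> [set y; c] = [set y; e] -> c = e.
  move=> yc ye /setP/(_ c); rewrite !inE eqxx orbT /=.
  by rewrite eq_sym (negPf (ny _ yc)) /= => /esym/eqP.
apply/negPn/negP; rewrite negb_or => /andP[ua ub].
(* Three distinct neighbours would give three edges at y. *)
have uabP c : c \in [:: u; a; b] -> adj G y c.
  by rewrite !inE => /or3P[] /eqP->.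
suff: (2 < deg G y)%N by rewrite dy.
have <- : #|[set [set y; c] | c in [:: u; a; b]]| = 3%N.
  rewrite card_in_imset; last first.
    by move=> c e /uabP yc /uabP ye; apply: inj.
  by apply/card_uniqP; rewrite /= !inE negb_or ua ub ab.
apply/subset_leq_card/subsetP => _ /imsetP[c /uabP yc ->].
by rewrite !inE eqxx andbT.
Qed.

Lemma adjwt_deg2 (G : wgraph R T) y a b u :
    deg G y = 2%N -> a != b -> adj G y a -> adj G y b ->
  adjwt G y u = if u == a then wt G [set y; a] else
                if u == b then wt G [set y; b] else 0.
Proof.
move=> dy ab ya yb; rewrite /adjwt (adj_deg2 _ dy ab ya yb).
by case: eqP => [->|_] //; case: eqP => [->|].
Qed.

Lemma eq_set2 (u v x z : T) : x != z ->
  ([set u; v] == [set x; z]) = (u == x) && (v == z) || (u == z) && (v == x).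
Proof.
move=> xz; apply/eqP/orP => [E|[] /andP[/eqP-> /eqP->] //]; last first.
  by rewrite setUC.
have := set21 u v; have := set22 u v; rewrite E.
have := set21 x z; have := set22 x z; rewrite -{1 2}E !inE.
move=> zuv xuv /orP[]/eqP vE /orP[]/eqP uE.
- by move: zuv; rewrite uE vE orbb eq_sym (negPf xz).
- by right; rewrite uE vE !eqxx.
- by left; rewrite uE vE !eqxx.
- by move: xuv; rewrite uE vE orbb (negPf xz).
Qed.

(** One reduction, on an arbitrary weighted graph. *)
Lemma path_reduction_inertia (G G' : wgraph R T) (x y1 y2 y3 y4 z : T) :
  path_reduction G x y1 y2 y3 y4 z G' ->
  pos_inertia G = (2 + pos_inertia G')%N /\
  neg_inertia G = (2 + neg_inertia G')%N.
Proof.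
move=> [[uq pth dg nxz] V' E' wxz wt'].
have {pth} [/and5P[a1 a2 a3 a4 a5]] : [&& adj G x y1, adj G y1 y2, adj G y2 y3,
  adj G y3 y4 & adj G y4 z] by move: pth; rewrite /= andbT.
set Y := [set y in _] in dg V' E' wt'.
set w1 := wt G [set x; y1] in wxz; set w2 := wt G [set y1; y2] in wxz.
set w3 := wt G [set y2; y3] in wxz; set w4 := wt G [set y3; y4] in wxz.
set w5 := wt G [set y4; z] in wxz.
have w2_gt0 : 0 < w2 := wt_gt0 a2.
have w4_gt0 : 0 < w4 := wt_gt0 a4.
have neE (u v : T) : u != v -> ((u == v) = false) * ((v == u) = false).
  by move=> uv; rewrite [v == u]eq_sym (negPf uv).
move: (uq); rewrite /= !inE !negb_or !andbT -!andbA.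
move=> /and5P[/neE n1 /neE n2 /neE n3 /neE n4 /and5P[/neE n5 /neE n6 /neE n7]].
move=> /neE n8 /and5P[/neE n9 /neE n10 /neE n11 /neE n12].
move=> /and3P[/neE n13 /neE n14 /neE n15].
have neT := (n1, n2, n3, n4, n5, n6, n7, n8, n9, n10, n11, n12, n13, n14, n15).
have dgY : [/\ deg G y1 = 2, deg G y2 = 2, deg G y3 = 2 & deg G y4 = 2]%N.
  by split; apply: dg; rewrite !inE eqxx ?orbT.
case: dgY {dg} => d1 d2 d3 d4.
(* The rows of the weighted adjacency matrix at the four deleted vertices. *)
have g1 u : adjwt G y1 u = if u == x then w1 else if u == y2 then w2 else 0.
  have r : adj G y1 x by rewrite adj_sym.
  by rewrite (adjwt_deg2 _ d1 _ r a2) ?neT // [[set y1; x]]setUC.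
have g2 u : adjwt G y2 u = if u == y1 then w2 else if u == y3 then w3 else 0.
  have r : adj G y2 y1 by rewrite adj_sym.
  by rewrite (adjwt_deg2 _ d2 _ r a3) ?neT // [[set y2; y1]]setUC.
have g3 u : adjwt G y3 u = if u == y2 then w3 else if u == y4 then w4 else 0.
  have r : adj G y3 y2 by rewrite adj_sym.
  by rewrite (adjwt_deg2 _ d3 _ r a4) ?neT // [[set y3; y2]]setUC.
have g4 u : adjwt G y4 u = if u == y3 then w4 else if u == z then w5 else 0.
  have r : adj G y4 y3 by rewrite adj_sym.
  by rewrite (adjwt_deg2 _ d4 _ r a5) ?neT // [[set y4; y3]]setUC.
have notY u : u \in verts G' -> [/\ u \in verts G, (u == y1) = false,
    (u == y2) = false, (u == y3) = false & (u == y4) = false].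
  by rewrite V' !inE !negb_or => /andP[/and4P[/negPf ? /negPf ? /negPf ? /negPf ?] ?].
have /andP[V1 V2] := adj_verts a2; have /andP[V3 V4] := adj_verts a4.
(* On the surviving vertices only the pair x, z changes. *)
have gG' u v : u \in verts G' -> v \in verts G' -> adjwt G' u v =
    if (u == x) && (v == z) || (u == z) && (v == x)
    then w1 * w3 * w5 / (w2 * w4) else adjwt G u v.
  move=> uV vV; have uvY : [disjoint [set u; v] & Y].
    rewrite -setI_eq0; apply/eqP/setP => e; rewrite in_setI in_set2 in_set0.
    apply/negP => /andP[/orP[] /eqP->]; rewrite !inE.
      by have [_ -> -> -> ->] := notY _ uV.
    by have [_ -> -> -> ->] := notY _ vV.
  rewrite /adjwt /adj E' in_setU1 in_set uvY andbT -eq_set2 ?neT //.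
  case: eqP => [->|_] //=; case: ifP => // uvG.
  by rewrite wt'.
(* h lists the vertices of G, the surviving ones first. *)
pose ys := [:: y1; y2; y3; y4].
pose ev (i : 'I_#|verts G'|) : T := enum_val i.
have evP i : ev i \in verts G' := enum_valP i.
pose h (k : 'I_(#|verts G'| + 4)) : T :=
  match split k with inl i => ev i | inr j => nth y1 ys j end.
pose A : 'M[R]_#|verts G'| := \matrix_(i, j) adjwt G (ev i) (ev j).
pose D := path4mx w2 w3 w4.
(* X solves B = X D, for B the block of edges from survivors to y1, ..., y4;
   its rows at vertices other than x and z are zero, the default of nth. *)
pose X : 'M[R]_(#|verts G'|, 4) := \matrix_(i, j) nth 0
  (if ev i == x then [:: 0; w1 / w2; 0; - (w1 * w3 / (w2 * w4))] else
   if ev i == z then [:: - (w3 * w5 / (w2 * w4)); 0; w5 / w4; 0] else [::]) j.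
have w20 : w2 != 0 by rewrite gt_eqF.
have w40 : w4 != 0 by rewrite gt_eqF.
have XD i j : (X *m D) i j = adjwt G (nth y1 ys j) (ev i).
  rewrite mxE !big_ord_recl big_ord0.
  have [_ e1 e2 e3 e4] := notY _ (evP i).
  case: j => [[|[|[|[|//]]]] j4]; rewrite !mxE /= ?g1 ?g2 ?g3 ?g4 ?e1 ?e2 ?e3 ?e4;
  have [ix|_] := eqVneq (ev i) x; rewrite ?ix ?neT /=;
    try (by field; rewrite ?w20 ?w40);
  have [_|_] := eqVneq (ev i) z; rewrite /=; by field; rewrite ?w20 ?w40.
have DE (i j : 'I_4) : D i j = adjwt G (nth y1 ys i) (nth y1 ys j).
  rewrite mxE; case: i => [[|[|[|[|//]]]] i4]; case: j => [[|[|[|[|//]]]] j4];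
  by rewrite /= ?g1 ?g2 ?g3 ?g4 ?neT ?eqxx.
have hE : \matrix_(i, j) adjwt G (h i) (h j) =
    block_mx A (X *m D) (X *m D)^T D.
  apply/matrixP => i j; rewrite [LHS]mxE [RHS]mxE /h.
  case: (split i) => i'; rewrite mxE; case: (split j) => j'.
  - by rewrite mxE.
  - by rewrite XD adjwt_sym.
  - by rewrite mxE XD.
  - by rewrite DE.
have schurE : A - X *m D *m X^T = adjmx G'.
  apply/matrixP => i j; rewrite [RHS]mxE -/(adjwt G' (ev i) (ev j)).
  rewrite gG' ?evP // mxE [A i j]mxE mxE [X in - X]mxE.
  under eq_bigr => k _ do rewrite XD.
  rewrite !big_ord_recl big_ord0 !mxE /=.
  have [_ e1 e2 e3 e4] := notY _ (evP i).
  rewrite g1 g2 g3 g4 e1 e2 e3 e4.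
  have nzx : adjwt G x z = 0 by rewrite /adjwt (negPf nxz).
  have [ix|_] := eqVneq (ev i) x; rewrite ?ix ?neT /=;
    have [jx|_] := eqVneq (ev j) x; rewrite ?jx ?neT /=;
    have [iz|_] := eqVneq (ev i) z; rewrite ?iz ?neT /=;
    have [jz|_] := eqVneq (ev j) z; rewrite ?jz ?neT /=;
    by rewrite ?(adjwt_sym G z x) ?nzx; field; rewrite ?w20 ?w40.
have As : A^T = A by apply/matrixP => i j; rewrite !mxE adjwt_sym.
have [pS nS] := inertia_schur X As (path4mx_sym w2 w3 w4).
have [pD nD] := inertia_path4mx w3 w2_gt0 w4_gt0.
have hV k : h k \in verts G.
  rewrite /h; case: (split k) => i; first by have [] := notY _ (evP i).
  by case: i => [[|[|[|[|//]]]] i4].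
have [] := @inertia_reindex R T (adjwt G) _ _
  (fun i : 'I_#|verts G| => enum_val i) h (adjwt_sym G).
- move=> i; have [iG'|] := boolP (enum_val i \in verts G').
    exists (unsplit (inl (enum_rank_in iG' (enum_val i)))).
    by rewrite /h unsplitK /ev enum_rankK_in.
  have -> : (enum_val i \in verts G') = (enum_val i \notin ys).
    by rewrite V' !inE enum_valP andbT.
  rewrite negbK => iY.
  have iy : (index (enum_val i) ys < 4)%N by rewrite index_mem.
  by exists (unsplit (inr (Ordinal iy))); rewrite /h unsplitK nth_index.
- by move=> j; exists (enum_rank_in (hV j) (h j)); rewrite enum_rankK_in.
rewrite hE pS nS pD nD schurE => pG nG.
by split; rewrite addnC.
Qed.
End Reduction.

Lemma theta_reduces_inertia (R : realType) (T : finType) (H G : wgraph R T)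
    k t s Pa Pc Pb :
  theta_reduces H k t s G Pa Pc Pb ->
  pos_inertia G = (2 * (k + s + t) + pos_inertia H)%N /\
  neg_inertia G = (2 * (k + s + t) + neg_inertia H)%N.
Proof.
elim=> {k t s G Pa Pc Pb} [Pa Pc Pb|k t s G G' Pa Pa' Pc Pb|k t s G G' Pa Pc Pc' Pb
    |k t s G G' Pa Pc Pb Pb'] //;
  move=> [s1 [s2 [x [y1 [y2 [y3 [y4 [z [_ _ /path_reduction_inertia[-> ->]]]]]]]]]];
  by move=> _ [-> ->]; split; lia.
Qed.

Theorem theorem4p9 (R : realType) (T : finType)
    (k s t p q l a b c : nat)
    (G H : wgraph R T) (Pa Pc Pb : seq T)
    (hp : (2 <= p <= 5)%N) (hq : (2 <= q <= 5)%N) (hl : (2 <= l <= 5)%N)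
    (h2 : ((p == 2) + (l == 2) + (q == 2) <= 1)%N)
    (ha : a = (4 * k + p)%N) (hb : b = (4 * s + q)%N) (hc : c = (4 * t + l)%N)
    (hG : is_theta a c b G Pa Pc Pb)
    (hH : theta_reduces H k t s G Pa Pc Pb) :
  pos_inertia G = (2 * (k + s + t) + pos_inertia H)%N /\
  neg_inertia G = (2 * (k + s + t) + neg_inertia H)%N.
Proof. exact: theta_reduces_inertia hH. Qed.
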